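(* Let $X$ be a uniformly perfect metric space, let $Y$ be a metric space, let $(\alpha_n)_{n\in\mathbb{N}}$ be a sequence with $0<\alpha_n<1$, let $E\subset X$ be $(\alpha_n)$-regular, and let $f:X\to Y$ be $\eta$-quasisymmetric. Then $f(E)\subset Y$ is $(\alpha_n)$-regular (for the same sequence $(\alpha_n)$).
   Context: $\mathbb{N}=\{1,2,\dots\}$. Balls are $B(x,r)=\{y: d(x,y)<r\}$. A metric space $X$ is uniformly perfect (with constant $D\ge1$) if it is not a singleton and $X\setminus B(x,r)\ne\emptyset$ implies $B(x,r)\setminus B(x,r/D)\neq\emptyset$, for all $x\in X$, $r>0$. A homeomorphism $f$ from $(X,d_X)$ onto $(Y,d_Y)$ is $\eta$-quasisymmetric if $\eta:[0,\infty)\to[0,\infty)$ is a homeomorphism such that for any three distinct points $x,y,z\in X$, $\frac{d_Y(f(x),f(y))}{d_Y(f(x),f(z))}\le\eta\left(\frac{d_X(x,y)}{d_X(x,z)}\right)$. $(\alpha_n)$-regular set: a subset $E$ of a metric space $X$ is $(\alpha_n)$-regular if there are Borel sets $\{Q_{k,i}: k\in\mathbb{N}, i\in N_k\}$ with $N_k\subset\mathbb{N}$, and constants $0<d\le 1$, $C_1\ge1$, $C_2\ge1$ such that: (I) $X=\bigcup_{i\in N_k}Q_{k,i}$ is a disjoint union for every $k$; (II) if $k\ge m$, $i\in N_k$, $j\in N_m$, then $Q_{k,i}\cap Q_{m,j}=\emptyset$ or $Q_{k,i}\subset Q_{m,j}$; (III) for every $k\in\mathbb{N}$, $i\in N_k$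 there are a point $x_{k,i}\in X$ and a radius $0<r_{k,i}<\infty$ with $B(x_{k,i},r_{k,i})\subset Q_{k,i}\subset B(x_{k,i},C_1r_{k,i})$; (IV) if $x_{n,i}\in Q_{n+1,j}$, then $\frac1{C_2}\alpha_n^{1/d}r_{n,i}\le r_{n+1,j}\le C_2\alpha_n^{d}r_{n,i}$ and $Q_{n,i}\setminus Q_{n+1,j}\ne\emptyset$; (V) for every $T>1$ there is $1\le C_3=C_3(T)<\infty$ such that for all $n$ and $i,j\in N_n$, $Q_{n,i}\cap B(x_{n,j},Tr_{n,j})\neq\emptyset$ implies $\frac1{C_3}r_{n,j}\le r_{n,i}\le C_3r_{n,j}$; (VI) $E=\bigcap_{n}E_n$, where $E_n=\bigcup_{i\in N_n}\{Q_{n,i}\setminus Q_{n+1,j}: x_{n,i}\in Q_{n+1,j}\}$. *)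

(* Defs.v *)
From HB Require Import structures.
From mathcomp Require Import all_boot all_order all_algebra.
From mathcomp Require Import all_classical all_reals all_analysis.
Set Implicit Arguments.
Unset Strict Implicit.
Unset Printing Implicit Defensive.
Import Order.TTheory GRing.Theory Num.Theory.
Import numFieldNormedType.Exports.
Local Open Scope classical_set_scope.
Local Open Scope ring_scope.

Definition uniformly_perfect (R : realType) (X : metricType R) : Prop :=
  (~ exists x : X, [set: X] = [set x]) /\
  exists2 D : R, 1 <= D &
    forall (x : X) (r : R), 0 < r ->
      [set: X] `\` ball x r !=set0 -> ball x r `\` ball x (r / D) !=set0.

Definition homeomorphism_on (T U : topologicalType)
    (A : set T) (B : set U) (f : T -> U) : Prop :=
  exists g : U -> T,
    [/\ set_fun A B f, set_fun B A g, {in A, cancel f g} & {in B, cancel g f}] /\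
    {within A, continuous f} /\ {within B, continuous g}.

(* Only the values of [eta] on [0, +oo[ matter. *)
Definition quasisymmetric (R : realType) (X Y : metricType R)
    (eta : R -> R) (f : X -> Y) : Prop :=
  [/\ homeomorphism_on [set: X] [set: Y] f,
      homeomorphism_on (`[0, +oo[%classic : set R) (`[0, +oo[%classic : set R)
        eta &
      forall x y z : X, x <> y -> y <> z -> x <> z ->
        mdist (f x) (f y) / mdist (f x) (f z) <= eta (mdist x y / mdist x z)].

(* Levels are numbered from 0 instead of 1: the numerical value of an index is
   never used.  The index set [N k] is coerced to a type, so that the sets
   [Q k i], the centres [x k i] and the radii [r k i] exist only for i in N k. *)
Record regular_system (R : realType) (X : metricType R)
    (alpha : nat -> R) (E : set X) (N : nat -> set nat)
    (Q : forall k, N k -> set X) (x : forall k, N k -> X)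
    (r : forall k, N k -> R) (d C1 C2 : R) : Prop := RegularSystem {
  regular_borel : forall k (i : N k), <<s @open X >> (Q k i);
  regular_d : 0 < d <= 1;
  regular_C1 : 1 <= C1;
  regular_C2 : 1 <= C2;
  regular_cover : forall k, \bigcup_(i : N k) Q k i = [set: X];
  regular_disjoint : forall k, trivIset [set: N k] (@Q k);
  regular_nested : forall k m, (m <= k)%N -> forall (i : N k) (j : N m),
    Q k i `&` Q m j = set0 \/ Q k i `<=` Q m j;
  regular_ball : forall k (i : N k),
    [/\ 0 < r k i,
        ball (x k i) (r k i) `<=` Q k i &
        Q k i `<=` ball (x k i) (C1 * r k i)];
  regular_radii : forall n (i : N n) (j : N n.+1), Q n.+1 j (x n i) ->
    C2^-1 * alpha n `^ d^-1 * r n i <= r n.+1 j <= C2 * alpha n `^ d * r n i /\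
    Q n i `\` Q n.+1 j !=set0;
  regular_neighbours : forall T : R, 1 < T -> exists2 C3 : R, 1 <= C3 &
    forall n (i j : N n), Q n i `&` ball (x n j) (T * r n j) !=set0 ->
      C3^-1 * r n j <= r n i <= C3 * r n j;
  regular_setE : E = \bigcap_n
    \bigcup_(ij in [set ij : N n * N n.+1 | Q n.+1 ij.2 (x n ij.1)])
      (Q n ij.1 `\` Q n.+1 ij.2)
}.

Definition regular_set (R : realType) (X : metricType R)
    (alpha : nat -> R) (E : set X) : Prop :=
  exists (N : nat -> set nat) (Q : forall k, N k -> set X)
    (x : forall k, N k -> X) (r : forall k, N k -> R) (d C1 C2 : R),
    regular_system alpha E Q x r d C1 C2.

(* Main.v *)
(* On a uniformly perfect space a quasisymmetry f has power-type distortion: by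
   uniform perfectness the ratio d(x,q)/d(x,w) can be shrunk (or expanded)
   through a chain of points in steps of bounded ratio, and each step changes
   the distances of the images by a fixed factor.  The sets f(Q) with centres
   f(x) then form a regular system.  Its radii are comparable to d(f(x), f(a)),
   where a is a point at distance comparable to r from x, and the power-type
   distortion turns the bounds (IV) with exponent d into the same bounds with
   exponent d * s. *)
Require Import Defs.
From mathcomp Require Import all_boot all_order all_algebra.
From mathcomp Require Import all_classical all_reals all_analysis.
From mathcomp Require Import ring lra.
Set Implicit Arguments.
Unset Strict Implicit.
Unset Printing Implicit Defensive.
Import Order.TTheory GRing.Theory Num.Theory.
Import numFieldNormedType.Exports.
Local Open Scope classical_set_scope.
Local Open Scope ring_scope.

(** * Moduli of distortion of a quasisymmetry *)

(** A continuous injection of an interval is monotone. A decreasing [eta] would stay below [eta 0]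
    and miss the value [eta 0 + 1], so [eta] increases; being onto it starts at [eta 0 = 0], whence
    the small values near [0]. *)
Lemma homeomorphism_halfline_gauge (R : realType) (eta : R -> R) :
  homeomorphism_on (`[0, +oo[%classic : set R) (`[0, +oo[%classic : set R)
    eta ->
  [/\ forall s t, 0 <= s -> s <= t -> eta s <= eta t,
      forall t, 0 <= t -> 0 <= eta t &
      forall e, 0 < e -> exists2 u, 0 < u < 1 & eta u <= e].
Proof.
have inE0 (t : R) : (t \in (`[0, +oo[%classic : set R)) = (0 <= t).
  by rewrite mem_setE in_itv/= andbT.
have inI0 (t : R) : (t \in `[0, +oo[) = (0 <= t) by rewrite in_itv/= andbT.
have in0 (t : R) : (`[0, +oo[%classic t) = (0 <= t).
  by rewrite /= in_itv/= andbT.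
move=> [g [[etaI gI etaK gK] [etaC _]]].
have eta_ge0 t : 0 <= t -> 0 <= eta t by rewrite -!in0 => /etaI.
have g_ge0 t : 0 <= t -> 0 <= g t by rewrite -!in0 => /gI.
have eta_inj : {in `[0, +oo[ &, injective eta}.
  move=> s t; rewrite !inI0 => s0 t0 st.
  by rewrite -[s]etaK ?inE0// st etaK ?inE0.
have eta_g t : 0 <= t -> eta (g t) = t by move=> t0; rewrite gK ?inE0.
have eta_le s t : 0 <= s -> s <= t -> eta s <= eta t.
  move=> s0 st.
  have [/le_mono_in mono|dec] := itv_continuous_inj_mono etaC eta_inj.
    by rewrite mono// inI0// (le_trans s0).
  have e1 : 0 <= eta 0 + 1 by rewrite addr_ge0// eta_ge0.
  have [g0|g0] := eqVneq (g (eta 0 + 1)) 0.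
    by have := eta_g _ e1; rewrite g0; lra.
  have := dec (g (eta 0 + 1)) 0; rewrite !inI0 lexx g_ge0// eta_g// lt_neqAle.
  rewrite eq_sym g0 g_ge0// => /(_ isT isT isT).
  by rewrite ltNge lerDl ler01.
split => // e e0.
have ge0 : 0 < g e.
  rewrite lt_neqAle g_ge0 ?(ltW e0)// andbT; apply/eqP => g0.
  have := eta_le 0 (g 0) (lexx _) (g_ge0 _ (lexx _)).
  have -> : eta 0 = e by rewrite g0 eta_g ?ltW.
  by rewrite eta_g// leNgt e0.
exists (Num.min (g e) 2^-1).
  by rewrite lt_min ge0/= gt_min invf_lt1 ?ltr0n// ltr1n orbT andbT invr_gt0 ltr0n.
rewrite -[leRHS](eta_g _ (ltW e0)) eta_le// ?ge_min ?lexx//.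
by rewrite le_min (ltW ge0) invr_ge0 ler0n.
Qed.

(* Quasisymmetry in multiplicative form; without quotients the points need not
   be distinct. *)
Definition gauge (R : realType) (X Y : metricType R) (f : X -> Y)
    (M : R -> R) : Prop :=
  [/\ forall K, 1 <= M K,
      forall K x y z, 0 <= K -> mdist x y <= K * mdist x z ->
        mdist (f x) (f y) <= M K * mdist (f x) (f z) &
      forall e, 0 < e -> exists2 u, 0 < u < 1 &
        forall x y z, mdist x y <= u * mdist x z ->
          mdist (f x) (f y) <= e * mdist (f x) (f z)].

Lemma quasisymmetric_gauge (R : realType) (X Y : metricType R)
    (eta : R -> R) (f : X -> Y) :
  quasisymmetric eta f -> exists M, gauge f M.
Proof.
move=> [[g [[_ _ fK _] _]] /homeomorphism_halfline_gauge[le ge0 small] qs].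
have f_inj x y : f x = f y -> x = y.
  by move=> fxy; rewrite -[x]fK ?in_setT// fxy fK ?in_setT.
have ctrl K x y z : 0 <= K -> y <> z -> mdist x y <= K * mdist x z ->
    mdist (f x) (f y) <= eta K * mdist (f x) (f z).
  move=> K0 yz xyz.
  have [xz|/eqP xz] := eqVneq x z.
    move: xyz; rewrite -xz mdistxx mulr0 => xy.
    have /mdist_positivity-> : mdist x y = 0.
      by apply/eqP; rewrite eq_le xy mdist_ge0.
    by rewrite !mdistxx mulr0.
  have [<-|/eqP xy] := eqVneq x y.
    by rewrite mdistxx mulr_ge0// ?ge0// mdist_ge0.
  have dxz : 0 < mdist x z by rewrite mdist_gt0; exact/eqP.
  have dfxz : 0 < mdist (f x) (f z).
    by rewrite mdist_gt0; apply/eqP => /f_inj.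
  rewrite -ler_pdivrMr// (le_trans (qs _ _ _ xy yz xz))// le//.
    by rewrite divr_ge0// mdist_ge0.
  by rewrite ler_pdivrMr.
(* The maximum with [1] settles the case [y = z], which the inequality for distinct points leaves
   open. *)
exists (fun K => Num.max 1 (eta K)); split.
- by move=> K; rewrite le_max lexx.
- move=> K x y z K0 xyz.
  have [->|/eqP yz] := eqVneq y z.
    by rewrite ler_peMl ?mdist_ge0// le_max lexx.
  by rewrite (le_trans (ctrl _ _ _ _ K0 yz xyz))// ler_wpM2r ?mdist_ge0// le_max lexx orbT.
- move=> e e0; have [u /andP[u0 u1] eu] := small _ e0.
  exists u; first exact/andP.
  (* If [y = z], then [u < 1] forces [x = z], and both image distances vanish. *)
  move=> x y z xyz; have [yz|/eqP yz] := eqVneq y z.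
    have : mdist x z <= 0.
      rewrite -yz in xyz *; have := mdist_ge0 x y; nra.
    rewrite le_eqVlt ltNge mdist_ge0/= orbF => /eqP/mdist_positivity xz.
    by rewrite yz -xz mdistxx mulr0.
  by rewrite (le_trans (ctrl _ _ _ _ (ltW u0) yz xyz))// ler_wpM2r ?mdist_ge0.
Qed.

(** * Power-type distortion on uniformly perfect spaces *)

(** The ball of radius [e * mdist x w] misses [w] because [e <= 1], so uniform perfectness puts a
    point in its outer shell. *)
Lemma uniformly_perfect_point (R : realType) (X : metricType R) :
  uniformly_perfect X -> exists2 D : R, 1 <= D &
    forall (x w : X) (e : R), x <> w -> 0 < e <= 1 ->
      exists2 z, x <> z & e / D * mdist x w <= mdist x z < e * mdist x w.
Proof.
move=> [_ [D D1 up]]; exists D => // x w e xw /andP[e0 e1].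
have xw0 : 0 < mdist x w by rewrite mdist_gt0; exact/eqP.
have D0 : 0 < D by rewrite (lt_le_trans ltr01).
have [|z] := up x (e * mdist x w) (mulr_gt0 e0 xw0).
  exists w; split => //; rewrite ballEmdist/= => /(le_lt_trans _).
  by move=> /(_ (e * mdist x w)); rewrite ltxx ler_piMl ?mdist_ge0// => /(_ isT).
rewrite !ballEmdist/= => -[xz /negP]; rewrite -leNgt mulrAC => xz'.
exists z; last by rewrite xz xz'.
move=> xz0; move: xz'; rewrite -xz0 mdistxx; apply/negP; rewrite -ltNge.
by rewrite !mulr_gt0 ?invr_gt0.
Qed.

(** Each step of the chain replaces [w] by a point [z] whose distance to [x] is between [e / D] and
    [e] times that of [w]. The lower bound uses up one factor [l = e / D], and the upper bound
    halves the image distance by the choice of [e]. *)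
Lemma gauge_contract (R : realType) (X Y : metricType R) (f : X -> Y)
    (M : R -> R) :
  uniformly_perfect X -> gauge f M ->
  exists2 l : R, 0 < l < 1 & forall K n x q w, 0 <= K ->
    mdist x q <= K * l ^+ n * mdist x w ->
    mdist (f x) (f q) <= M K * 2^-1 ^+ n * mdist (f x) (f w).
Proof.
move=> /uniformly_perfect_point[D D1 up] [M1 Mf Me].
have [|e /andP[e0 e1] He] := Me 2^-1; first by rewrite invr_gt0 ltr0n.
have D0 : 0 < D by rewrite (lt_le_trans ltr01).
have l0 : 0 < e / D by rewrite divr_gt0.
exists (e / D).
  by rewrite l0 ltr_pdivrMr// mul1r (lt_le_trans e1).
move=> K n x q w K0; elim: n w => [|n IH] w.
  by rewrite !expr0 !mulr1; exact: Mf.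
have [<-|/eqP xw] := eqVneq x w.
  rewrite !mdistxx !mulr0 => xq.
  by have := Mf 0 x q x (lexx _); rewrite mul0r mdistxx mulr0 => ->.
have [|z xz /andP[zl zu]] := up x w e xw; first by rewrite e0 ltW.
move=> xq; apply: le_trans (IH z _) _.
  rewrite (le_trans xq)// exprSr mulrA -mulrA ler_wpM2l// mulr_ge0//.
  by rewrite exprn_ge0 ?ltW.
rewrite exprSr mulrA -[leRHS]mulrA ler_wpM2l//.
  by rewrite mulr_ge0 ?exprn_ge0 ?invr_ge0 ?ler0n// (le_trans ler01).
by rewrite He// ltW.
Qed.

(** Here the chain moves [q] towards [x]: the new point is at most half as far, which uses up one
    factor [2], and at least [1 / (2 * D)] times as far, so the image distance drops at most by the
    factor [M (2 * D)]. *)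
Lemma gauge_expand (R : realType) (X Y : metricType R) (f : X -> Y)
    (M : R -> R) :
  uniformly_perfect X -> gauge f M ->
  exists L : R, 1 < L /\ forall K n x q w, 0 <= K ->
    mdist x q <= K * 2 ^+ n * mdist x w ->
    mdist (f x) (f q) <= M K * L ^+ n * mdist (f x) (f w).
Proof.
move=> /uniformly_perfect_point[D D1 up] [M1 Mf Me].
have D0 : 0 < D by rewrite (lt_le_trans ltr01).
(* The summand [1] makes [L] strictly larger than [1], so that [L^-1] can later be written as a
   positive power of [2^-1]. *)
exists (M (2 * D) + 1); split; first by rewrite ltr_pwDr.
have L0 : 0 <= M (2 * D) + 1 by have := M1 (2 * D); lra.
move=> K n x q w K0; elim: n q => [|n IH] q.
  by rewrite !expr0 !mulr1; exact: Mf.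
have [<- _|/eqP xq] := eqVneq x q.
  by rewrite mdistxx !mulr_ge0 ?exprn_ge0 ?mdist_ge0// (le_trans ler01).
have [|z xz /andP[zl zu]] := up x q 2^-1 xq; first by lra.
move=> xqw.
have /IH fz : mdist x z <= K * 2 ^+ n * mdist x w.
  by move: xqw; rewrite exprSr; lra.
rewrite (@le_trans _ _ (M (2 * D) * mdist (f x) (f z)))//.
  apply: Mf; first by rewrite mulr_ge0// ltW.
  by move: zl; rewrite -invfM ler_pdivrMl// mulr_gt0.
rewrite exprSr; apply: le_trans (_ : (M (2 * D) + 1) * mdist (f x) (f z) <= _).
  by rewrite ler_wpM2r ?mdist_ge0//; lra.
rewrite [leRHS](_ : _ = (M (2 * D) + 1) *
  (M K * (M (2 * D) + 1) ^+ n * mdist (f x) (f w))); last by ring.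
by rewrite ler_wpM2l.
Qed.

Lemma geometric_scale (R : realType) (l t : R) : 0 < l < 1 -> 0 < t <= 1 ->
  exists n, l ^+ n.+1 < t <= l ^+ n.
Proof.
move=> /andP[l0 l1] /andP[t0 t1].
have ex : exists n, l ^+ n < t.
  have : (fun n => l ^+ n) @ \oo --> (0 : R) by apply: cvg_expr; rewrite gtr0_norm.
  move=> /cvgrPdist_lt/(_ t t0)[n _ /(_ n (leqnn n))].
  by rewrite /= sub0r normrN gtr0_norm ?exprn_gt0// => ?; exists n.
case: (ex_minnP ex) => -[|n] nt min; first by move: nt; rewrite expr0 ltNge t1.
exists n; rewrite nt /= leNgt; apply/negP => /min.
by rewrite ltnn.
Qed.

(** The exponent [ln m / ln l] is positive since both logarithms are negative. This turns a number
    of chain steps into a power of the scale. *)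
Lemma exprn_powR (R : realType) (l m : R) : 0 < l < 1 -> 0 < m < 1 ->
  exists2 p, 0 < p & forall n, m ^+ n = (l ^+ n) `^ p.
Proof.
move=> /andP[l0 l1] /andP[m0 m1].
have lnl : ln l < 0 by rewrite ln_lt0// l0.
have lnm : ln m < 0 by rewrite ln_lt0// m0.
exists (ln m / ln l) => [|n]; first by rewrite -mulrNN -invrN divr_gt0 ?oppr_gt0.
rewrite -[in RHS]powR_mulrn ?ltW// powRAC powR_mulrn ?powR_ge0//.
by rewrite [in RHS]/powR gt_eqF// -mulrA mulVf ?lt_eqF// mulr1 lnK.
Qed.

Lemma gauge_power (R : realType) (X Y : metricType R) (f : X -> Y)
    (M : R -> R) :
  uniformly_perfect X -> gauge f M ->
  exists2 s : R, 0 < s <= 1 &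
    forall K, 0 <= K -> exists2 C, 1 <= C &
      forall t x q w, 0 < t <= 1 ->
        (mdist x q <= K * t * mdist x w ->
           mdist (f x) (f q) <= C * t `^ s * mdist (f x) (f w)) /\
        (mdist x q <= K / t * mdist x w ->
           mdist (f x) (f q) <= C / t `^ s^-1 * mdist (f x) (f w)).
Proof.
move=> up gf; have [M1 _ _] := gf.
have [l l01 con] := gauge_contract up gf.
have [L [L1 expd]] := gauge_expand up gf.
have L0 : 0 < L by rewrite (lt_trans ltr01).
have h01 : 0 < 2^-1 :> R by rewrite invr_gt0 ltr0n.
have h1 : 0 < (2^-1 : R) < 1 by lra.
have [p p0 hp] := exprn_powR l01 h1.
have [|p' p'0 hp'] := @exprn_powR _ 2^-1 L^-1 h1.
  by rewrite invr_gt0 L0 invf_lt1.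
(* One [s] serves both bounds: [s <= p] and [p' <= s^-1], and powers of [t <= 1] decrease in the
   exponent. *)
pose s := Num.min 1 (Num.min p p'^-1).
have s0 : 0 < s by rewrite !lt_min ltr01 p0 invr_gt0.
exists s; first by rewrite s0 ge_min lexx.
have sp : s <= p by rewrite !ge_min lexx !orbT.
have sp' : p' <= s^-1.
  by rewrite -[leLHS]invrK lef_pV2 ?posrE ?invr_gt0// !ge_min lexx !orbT.
move=> K K0; have MK := M1 K; exists (2 * L * M K); first by nra.
move=> t x q w t01; have /andP[t0 t1] := t01; split=> xqw.
- have [n /andP[nt tn]] := geometric_scale l01 t01.
  have := con K n x q w K0 => /(_ _)/le_trans; apply.
    by rewrite (le_trans xqw)// ler_wpM2r ?mdist_ge0// ler_wpM2l.
  rewrite ler_wpM2r ?mdist_ge0//.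
  (* The bound [l ^+ n.+1 < t] controls only the power [n.+1]; the spare factor [2] goes into the
     constant. *)
  have : 2^-1 ^+ n.+1 <= t `^ s.
    rewrite hp (@le_trans _ _ (t `^ p))//.
      by rewrite ge0_ler_powR ?nnegrE ?ltW ?exprn_gt0//; case/andP: l01.
    by rewrite ger_powR// t0.
  rewrite exprS => ts; have u0 : 0 <= t `^ s by exact: powR_ge0.
  apply: le_trans (_ : M K * (2 * t `^ s) <= _).
    by rewrite ler_wpM2l; lra.
  rewrite [leRHS](_ : _ = L * (M K * (2 * t `^ s))); last by ring.
  by rewrite ler_peMl ?(ltW L1)// !mulr_ge0//; lra.
- have [n /andP[nt tn]] := geometric_scale h1 t01.
  (* Since [t] exceeds [2^-1 ^+ n.+1], covering [t^-1] takes [n.+1] doublings; the extra factor [L]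
     goes into the constant. *)
  have := expd K n.+1 x q w K0 => /(_ _)/le_trans; apply.
    rewrite (le_trans xqw)// ler_wpM2r ?mdist_ge0// ler_wpM2l//.
    by rewrite -[leRHS]invrK -exprVn lef_pV2 ?posrE ?exprn_gt0// ltW.
  rewrite ler_wpM2r ?mdist_ge0//.
  have : t `^ s^-1 <= L^-1 ^+ n.
    rewrite hp' (@le_trans _ _ (t `^ p'))//; first by rewrite ger_powR// t0.
    by rewrite ge0_ler_powR ?nnegrE ?(ltW p'0) ?(ltW t0) ?exprn_ge0 ?(ltW h01).
  rewrite exprVn => ts.
  have u0 : 0 < t `^ s^-1 by exact: powR_gt0.
  have : L ^+ n <= (t `^ s^-1)^-1.
    by rewrite -[leLHS]invrK lef_pV2 ?posrE ?invr_gt0 ?exprn_gt0.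
  rewrite exprS; move: (L ^+ n) => v vu.
  have ui : 0 <= (t `^ s^-1)^-1 by rewrite invr_ge0 ltW.
  have ? : M K * (L * v) <= M K * (L * (t `^ s^-1)^-1).
    by rewrite !ler_wpM2l//; lra.
  have ? : 0 <= M K * (L * (t `^ s^-1)^-1) by rewrite !mulr_ge0//; lra.
  by lra.
Qed.

(** * Comparing image distances at different centres *)

(** Both [y] and [b] lie within [2 * K * mdist x a] of [x], so the triangle inequality through [f x]
    gives twice the modulus at [2 * K]. *)
Lemma gauge_compare (R : realType) (X Y : metricType R) (f : X -> Y)
    (M : R -> R) (K : R) (x a y b : X) :
  gauge f M -> 0 <= K ->
  mdist x y <= K * mdist x a -> mdist y b <= K * mdist x a ->
  mdist (f y) (f b) <= 2 * M (2 * K) * mdist (f x) (f a).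
Proof.
move=> [_ Mf _] K0 xy yb.
have K20 : 0 <= 2 * K by rewrite mulr_ge0.
have xb := metric_triangle x y b.
have da := mdist_ge0 x a.
have Ka : 0 <= K * mdist x a by rewrite mulr_ge0.
have := Mf _ x y a K20 => /(_ ltac:(lra)) fxy.
have := Mf _ x b a K20 => /(_ ltac:(lra)) fxb.
have := metric_triangle (f y) (f x) (f b).
by rewrite (metric_sym (f y) (f x)); lra.
Qed.

(** The power bounds compare distances from a single point, whereas here the pairs [(x, a)] and
    [(y, b)] have different base points. Everything is measured from [y]: in the first bound
    [(x, a)] is traded for a pair [(y, w)], in the second [x] and [a] are both compared with [b]. *)
Lemma gauge_radii (R : realType) (X Y : metricType R) (f : X -> Y)
    (M : R -> R) :
  uniformly_perfect X -> gauge f M ->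
  exists2 s : R, 0 < s <= 1 &
    forall K, 0 <= K -> exists2 C, 1 <= C &
      forall t x a y b, 0 < t <= 1 ->
        (mdist x y <= K * mdist x a -> mdist y b <= K * t * mdist x a ->
           mdist (f y) (f b) <= C * t `^ s * mdist (f x) (f a)) /\
        (mdist y x <= K * mdist y b -> mdist x a <= K / t * mdist y b ->
           mdist (f x) (f a) <= C / t `^ s^-1 * mdist (f y) (f b)).
Proof.
move=> up gf; have [M1 Mf _] := gf.
have [s s01 hs] := gauge_power up gf.
exists s => // K K0.
have [C C1 hC] : exists2 C, 1 <= C & _ := hs (2 * K) (mulr_ge0 (ler0n _ _) K0).
have MK := M1 K.
exists (C * (M K + 1)); first by nra.
move=> t x a y b t01; have /andP[t0 t1] := t01; split=> [xy yb|yx xa].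
- have tri := metric_triangle x y a.
  have tp : 0 <= t `^ s by exact: powR_ge0.
  have Kt : 0 <= K * t by rewrite mulr_ge0// ltW.
  have fxy := Mf _ _ _ _ K0 xy.
  have fx0 := mdist_ge0 (f x) (f a).
  (* One of a, x lies at distance at least d(x,a)/2 from y. *)
  have [w [yw fyw]] : exists w, mdist x a <= 2 * mdist y w /\
      mdist (f y) (f w) <= (M K + 1) * mdist (f x) (f a).
    have [h|h] := leP (mdist x a) (2 * mdist y a).
      exists a; split=> //.
      have := metric_triangle (f y) (f x) (f a).
      by rewrite (metric_sym (f y) (f x)); lra.
    exists x; rewrite (metric_sym (f y)) (metric_sym y); split; lra.
  have [h _] := hC t y b w t01.
  have {}h := h ltac:(nra).
  rewrite (le_trans h)//.
  rewrite [leRHS](_ : _ = C * t `^ s * ((M K + 1) * mdist (f x) (f a))); last by ring.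
  by rewrite ler_wpM2l// mulr_ge0//; lra.
- have tri := metric_triangle y x a.
  have yb0 := mdist_ge0 y b.
  have fyb0 := mdist_ge0 (f y) (f b).
  have ti : 1 <= t^-1 by rewrite invf_ge1.
  have Kt : K <= K / t by rewrite ler_peMr.
  have Kt' : K * mdist y b <= K / t * mdist y b by rewrite ler_wpM2r.
  have Kb : 0 <= K * mdist y b by rewrite mulr_ge0.
  have [_ hx] := hC t y x b t01.
  have [_ ha] := hC t y a b t01.
  have {}hx := hx ltac:(lra).
  have {}ha := ha ltac:(lra).
  have := metric_triangle (f x) (f y) (f a).
  rewrite (metric_sym (f x) (f y)).
  have u0 : 0 <= C / t `^ s^-1 * mdist (f y) (f b).
    by rewrite mulr_ge0// divr_ge0 ?powR_ge0//; lra.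
  (* As [M K] is at least [1], the two summands of the triangle inequality fit into the factor
     [M K + 1]. *)
  have : 1 * (C / t `^ s^-1 * mdist (f y) (f b)) <= M K *  (C / t `^ s^-1 * mdist (f y) (f b)).
    by rewrite ler_wpM2r.
  by lra.
Qed.

(** Shaped for condition (V), with [p] and [q] the radii at [x] and [y]: all distances involved are
    at most [A * (1 + B) * p], hence at most [A * (1 + B) * D * mdist x a]. *)
Lemma gauge_neighbours (R : realType) (X Y : metricType R) (f : X -> Y)
    (M : R -> R) (A B D p q : R) (x a y b : X) :
  gauge f M -> 1 <= A -> 1 <= B -> 1 <= D -> 0 < p -> 0 < q ->
  mdist x y <= A * (p + q) -> q <= B * p ->
  p <= D * mdist x a -> mdist y b <= q ->
  mdist (f y) (f b) <= 2 * M (2 * (A * (1 + B) * D)) * mdist (f x) (f a).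
Proof.
move=> gf A1 B1 D1 p0 q0 xy qp pa bq; apply: gauge_compare => //.
- by rewrite !mulr_ge0//; lra.
- rewrite -[leRHS]mulrA; apply: le_trans (_ : A * (1 + B) * p <= _).
    by rewrite -mulrA (le_trans xy)// ler_wpM2l//; lra.
  by rewrite ler_wpM2l// mulr_ge0; lra.
- rewrite -[leRHS]mulrA; apply: le_trans (_ : A * (1 + B) * p <= _).
    rewrite (le_trans bq)// (le_trans qp)// ler_wpM2r ?ltW//.
    by clear -A1 B1; nra.
  by rewrite ler_wpM2l// mulr_ge0; lra.
Qed.

(** Shaped for condition (IV), with [p] the radius at one level, [q] the radius at the next and [t]
    a power of [alpha n]. *)
Lemma gauge_successor (R : realType) (X Y : metricType R) (f : X -> Y)
    (M : R -> R) :
  uniformly_perfect X -> gauge f M ->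
  exists2 s : R, 0 < s <= 1 &
    forall A B D, 1 <= A -> 1 <= B -> 1 <= D -> exists2 C, 1 <= C &
      forall t p q x a y b, 0 < t <= 1 -> 0 < p -> 0 < q ->
        mdist x y <= A * q ->
        p <= D * mdist x a -> mdist x a <= p ->
        q <= D * mdist y b -> mdist y b <= q ->
        (q <= B * t * p ->
           mdist (f y) (f b) <= C * t `^ s * mdist (f x) (f a)) /\
        (B^-1 * t * p <= q ->
           mdist (f x) (f a) <= C / t `^ s^-1 * mdist (f y) (f b)).
Proof.
move=> up gf; have [s s01 hs] := gauge_radii up gf; exists s => //.
move=> A B D A1 B1 D1.
have [A0 B0 D0] : [/\ 0 <= A, 0 <= B & 0 <= D] by split; lra.
have [C C1 hC] := hs (A * B * D) (mulr_ge0 (mulr_ge0 A0 B0) D0).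
exists C => // t p q x a y b t01 p0 q0 xy pa ap qb bq.
have [h1 h2] := hC t x a y b t01; have /andP[t0 t1] := t01.
split=> [qp|pq]; [apply: h1|apply: h2].
- rewrite (le_trans xy)// -!mulrA ler_wpM2l//.
  rewrite (le_trans qp)// -mulrA ler_wpM2l// (le_trans _ pa)//.
  by rewrite ler_piMl// ltW.
- rewrite (le_trans bq)// (le_trans qp)//.
  rewrite [leRHS](_ : _ = A * (B * t * (D * mdist x a))); last by ring.
  apply: le_trans (_ : B * t * (D * mdist x a) <= _).
    by rewrite ler_wpM2l// mulr_ge0// ltW.
  by rewrite ler_peMl// !mulr_ge0 ?mdist_ge0// ltW.
- rewrite metric_sym (le_trans xy)// -!mulrA ler_wpM2l//.
  by rewrite (le_trans qb)// ler_peMl// mulr_ge0 ?mdist_ge0.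
- have pq' : p <= B / t * q.
    rewrite mulrAC ler_pdivlMr// mulrC -ler_pdivrMl ?mulrA//.
    by rewrite (lt_le_trans ltr01).
  have Bt0 : 0 <= B / t by rewrite divr_ge0// ltW.
  rewrite (le_trans ap)// (le_trans pq')//.
  rewrite [leRHS](_ : _ = A * (B / t * (D * mdist y b))); last by ring.
  apply: le_trans (_ : B / t * (D * mdist y b) <= _).
    by rewrite ler_wpM2l.
  by rewrite ler_peMl// mulr_ge0// mulr_ge0// mdist_ge0.
Qed.

(** * Borel preimages and reference points of a regular system *)

(** The sets with Borel preimage form a sigma-algebra containing the open sets. *)
Lemma preimage_borel (T U : topologicalType) (g : U -> T) (A : set T) :
  continuous g -> <<s @open T >> A -> <<s @open U >> (g @^-1` A).
Proof.
move=> gC mA.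
pose S := [set B : set T | <<s @open U >> (g @^-1` B)].
apply: (mA S); split=> [|B oB]; last first.
  by apply: sub_sigma_algebra; exact: open_comp.
have [S0 SC SU] := @smallest_sigma_algebra U setT (@open U).
split; rewrite /S /=.
- by rewrite preimage_set0.
- by move=> B /SC; rewrite !setTD preimage_setC.
- by move=> F /SU; rewrite preimage_bigcup.
Qed.

(* A ball of the system may have a radius far beyond the diameter of X, but
   only if its set Q is all of X; this happens at most once. *)
Lemma regular_system_level0 (R : realType) (X : metricType R)
    (alpha : nat -> R) (E : set X) (N : nat -> set nat)
    (Q : forall k, N k -> set X) (x : forall k, N k -> X)
    (r : forall k, N k -> R) (d C1 C2 : R) k (i : N k) :
  regular_system alpha E Q x r d C1 C2 -> Q k i = [set: X] -> k = 0%N.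
Proof.
move=> S QT; case: k i QT => // k i QT.
have : [set: X] (x _ i) by [].
rewrite -(regular_cover S k) => -[j _ xj].
have [|sub] := regular_nested S (leqnSn k) i j.
  by rewrite QT setTI => Qj0; rewrite Qj0 in xj.
(* A set filling [X] contains the centre of the set [j] one level earlier, and (IV) then asks for a
   point outside [X]. *)
have := regular_radii S (i := j) (j := i); rewrite QT => /(_ I)[_ [z [_ nz]]].
by exfalso; exact: nz.
Qed.

(** Uniform perfectness provides [a] unless the ball is all of [X]. That exception concerns at most
    one index, at level [0], so its own ratio of radius to distance can be absorbed into [D]. *)
Lemma regular_system_point (R : realType) (X : metricType R)
    (alpha : nat -> R) (E : set X) (N : nat -> set nat)
    (Q : forall k, N k -> set X) (x : forall k, N k -> X)
    (r : forall k, N k -> R) (d C1 C2 : R) :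
  uniformly_perfect X -> regular_system alpha E Q x r d C1 C2 ->
  exists2 D, 1 <= D &
    forall k (i : N k), exists a, r k i <= D * mdist (x k i) a /\
                                  mdist (x k i) a < r k i.
Proof.
move=> [notsing [D D1 up]] S.
have D0 : 0 < D by rewrite (lt_le_trans ltr01).
have large k (i : N k) : ball (x k i) (r k i) <> setT ->
    exists a, r k i <= D * mdist (x k i) a /\ mdist (x k i) a < r k i.
  move=> bT; have [r0 _ _] := regular_ball S i.
  have [|a []] := up (x k i) _ r0.
    by apply/set0P/eqP; rewrite setTD => /(congr1 (@setC _)); rewrite setCK setC0.
  rewrite !ballEmdist /= => ar /negP; rewrite -leNgt ler_pdivrMr// mulrC => ra.
  by exists a.
have [[i0 b0]|no] := pselect (exists i0 : N 0, ball (x 0 i0) (r 0 i0) = setT).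
  have [r0 _ _] := regular_ball S i0.
  have [a0 xa] : exists a0, x 0 i0 <> a0.
    apply: contrapT => /forallNP na; apply: notsing; exists (x 0 i0).
    apply/seteqP; split=> [z _|//]; have /contrapT := na z; exact: esym.
  have xa0 : 0 < mdist (x 0 i0) a0 by rewrite mdist_gt0; exact/eqP.
  exists (Num.max D (r 0 i0 / mdist (x 0 i0) a0)); first by rewrite le_max D1.
  move=> k i; have [bT|/large[a [ra ar]]] := pselect (ball (x k i) (r k i) = setT).
    have QT : Q k i = setT.
      by rewrite -subTset -bT; have [] := regular_ball S i.
    have k0 := regular_system_level0 S QT; subst k.
    have -> : i = i0.
      apply: (regular_disjoint S) => //; exists (x 0 i0); rewrite QT; split=> //.
      have [r0' + _] := regular_ball S i0; apply; rewrite ballEmdist/= mdistxx//.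
    exists a0; split; first by rewrite -ler_pdivrMr// le_max lexx orbT.
    have : ball (x 0 i0) (r 0 i0) a0 by rewrite b0.
    by rewrite ballEmdist.
  exists a; split=> //; rewrite (le_trans ra)// ler_wpM2r ?mdist_ge0//.
  by rewrite le_max lexx.
exists D => // k i; apply: large => bT.
have QT : Q k i = setT.
  by rewrite -subTset -bT; have [] := regular_ball S i.
have k0 := regular_system_level0 S QT; subst k.
by apply: no; exists i.
Qed.

Theorem lemma2p1 (R : realType) (X Y : metricType R) (alpha : nat -> R)
    (E : set X) (eta : R -> R) (f : X -> Y)
    (hX : uniformly_perfect X)
    (halpha : forall n, 0 < alpha n < 1)
    (hE : regular_set alpha E)
    (hf : quasisymmetric eta f) :
  regular_set alpha (f @` E).
Proof.
have [M gf] := quasisymmetric_gauge hf.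
have [M1 Mf Me] := gf.
have [[g [[_ _ fK' gK'] [_ gC']]] _ _] := hf.
have fK z : g (f z) = z by rewrite fK' ?in_setT.
have gK z : f (g z) = z by rewrite gK' ?in_setT.
have gC : continuous g by move: gC'; rewrite continuous_subspace_setT.
have [N [Q [x [r [d [C1 [C2 S]]]]]]] := hE.
have [D D1 hD] := regular_system_point hX S.
pose a k (i : N k) := projT1 (cid (hD k i)).
have ra k (i : N k) : r k i <= D * mdist (x k i) (a k i).
  by rewrite /a; case: cid => ? [].
have ar k (i : N k) : mdist (x k i) (a k i) < r k i.
  by rewrite /a; case: cid => ? [].
have rho0 k (i : N k) : 0 < mdist (f (x k i)) (f (a k i)).
  rewrite mdist_gt0; apply/eqP => /(congr1 g); rewrite !fK => xa.
  have [r0 _ _] := regular_ball S i.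
  by have := ra k i; rewrite -xa mdistxx mulr0 leNgt r0.
have [s /andP[s0 s1] hs] := gauge_successor hX gf.
have /andP[d0 d1] := regular_d S.
have C11 := regular_C1 S.
have C21 := regular_C2 S.
have M11 := M1 1.
have [C' C'1 hC'] := hs C1 C2 D C11 C21 D1.
have QE k (i : N k) z : Q k i z -> mdist (x k i) z < C1 * r k i.
  by have [_ _ h] := regular_ball S i; move=> /h; rewrite ballEmdist.
have rge0 k (i : N k) : 0 < r k i by have [] := regular_ball S i.
(* Images under [f] are written as preimages under [g], which commute with set operations. Dividing
   by [M 1] puts the inner ball inside the image: a point outside the ball around [x k i] is farther
   than [a k i], so its image is at distance at least [mdist (f (x k i)) (f (a k i)) / M 1]. The
   summand [1] in the outer constant makes the outer inclusion strict. *)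
exists N, (fun k i => g @^-1` Q k i), (fun k i => f (x k i)),
  (fun k i => mdist (f (x k i)) (f (a k i)) / M 1), (d * s),
  (M 1 * (M (C1 * D) + 1)), C'.
split.
- move=> k i; exact: (preimage_borel gC (regular_borel S i)).
- by rewrite mulr_gt0//= mulr_ile1// ltW.
- by have := M1 (C1 * D); nra.
- exact: C'1.
- by move=> k; rewrite -preimage_bigcup (regular_cover S) preimage_setT.
- move=> k i j _ _ [z [iz jz]].
  by apply: (regular_disjoint S) => //; exists (g z).
- move=> k m mk i j; have [QQ|sub] := regular_nested S mk i j.
    by left; rewrite -preimage_setI QQ preimage_set0.
  by right => z /sub.
- move=> k i; split.
  + by rewrite divr_gt0// (lt_le_trans ltr01).
  + move=> z; rewrite ballEmdist/= ltr_pdivlMr ?(lt_le_trans ltr01)// => fxz.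
    have [_ h _] := regular_ball S i; apply: h; rewrite ballEmdist/= ltNge.
    apply/negP => rxz; move: fxz; apply/negP; rewrite -leNgt mulrC -(gK z).
    by apply: Mf => //; rewrite mul1r (le_trans _ rxz)// ltW.
  + move=> z /QE xz; rewrite ballEmdist/= -(gK z).
    have MC := M1 (C1 * D).
    have CD0 : 0 <= C1 * D by rewrite mulr_ge0//; lra.
    have := Mf (C1 * D) (x k i) (g z) (a k i) CD0 => /(_ _)/le_lt_trans -> //.
      rewrite (le_trans (ltW xz))// -mulrA ler_wpM2l//; lra.
    rewrite [ltRHS](_ : _ = (M (C1 * D) + 1) * mdist (f (x k i)) (f (a k i))).
      by rewrite ltr_pM2r// ltrDl.
    by field; rewrite gt_eqF// (lt_le_trans ltr01).
- move=> n i j; rewrite /= fK => Qx.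
  have [/andP[rl ru] [z [Qz nQz]]] := regular_radii S Qx.
  split; last by exists (f z); rewrite /= fK.
  have /andP[al0 al1] := halpha n.
  have xx := QE _ _ _ Qx; rewrite metric_sym in xx.
  set p := mdist (f (x n i)) (f (a n i)).
  set q := mdist (f (x n.+1 j)) (f (a n.+1 j)).
  have powle u : 0 < u -> 0 < alpha n `^ u <= 1.
    move=> u0; rewrite powR_gt0//= -(powRr0 (alpha n)) ger_powR ?al0 ?ltW//.
  (* Used with [u = d] for the upper bound and [u = d^-1] for the lower one; the powers [s] and
     [s^-1] then give the exponents [d * s] and [(d * s)^-1]. *)
  have step u (u0 : 0 < u) := hC' _ _ _ _ (a n i) _ (a n.+1 j)
    (powle u u0) (rge0 n i) (rge0 n.+1 j) (ltW xx)
    (ra n i) (ltW (ar n i)) (ra n.+1 j) (ltW (ar n.+1 j)).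
  have upper : q <= C' * alpha n `^ (d * s) * p.
    by rewrite powRrM; exact: (step _ d0).1.
  have lower : p <= C' / alpha n `^ (d * s)^-1 * q.
    have di : 0 < d^-1 by rewrite invr_gt0.
    by rewrite invfM powRrM; exact: (step _ di).2.
  have M0 : 0 < M 1 by rewrite (lt_le_trans ltr01).
  have C'0 : 0 < C' by rewrite (lt_le_trans ltr01).
  have w0 : 0 < alpha n `^ (d * s)^-1 by exact: powR_gt0.
  rewrite !mulrA !ler_pM2r ?invr_gt0// upper andbT.
  by rewrite -mulrA ler_pdivrMl// mulrC -ler_pdivlMr// (le_trans lower)//; lra.
- move=> T T1.
  have T0 : 0 < T by rewrite (lt_trans ltr01).
  have M0 : 0 < M 1 by rewrite (lt_le_trans ltr01).
  (* This [u] pulls the enlarged image ball back into the ball of radius [u^-1 * r n j]: for a point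
     farther away, [a n j] would be relatively so close that the image of the point falls outside
     the enlarged ball. Condition (V) in [X] is then applied with [u^-1]. *)
  have [|u /andP[u0 u1] hu] := Me (M 1 / T); first by rewrite divr_gt0.
  have [|C3 C31 hC3] := regular_neighbours S (T := u^-1); first by rewrite invf_gt1.
  have v0 : 0 < u^-1 by rewrite invr_gt0.
  have A1 : 1 <= C1 + u^-1 by rewrite ler_wpDr// ltW.
  pose c := 2 * M (2 * ((C1 + u^-1) * (1 + C3) * D)).
  have c1 : 1 <= c by rewrite mulr_ege1// ler1n.
  exists c => //.
  move=> n i j [z [Qz]]; rewrite ballEmdist /= -{1}(gK z) => fz.
  have xz : mdist (x n j) (g z) < u^-1 * r n j.
    rewrite ltNge ler_pdivrMl//; apply/negP => rz.
    have := hu _ _ _ (le_trans (ltW (ar n j)) rz).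
    apply/negP; rewrite -ltNge.
    rewrite [ltRHS](_ : _ = M 1 / T *
      (T * (mdist (f (x n j)) (f (a n j)) / M 1))); last first.
      by field; rewrite !gt_eqF.
    by rewrite ltr_pM2l ?divr_gt0.
  have /andP[rl ru] := hC3 n i j ltac:(by exists (g z); rewrite ballEmdist).
  have xij : mdist (x n i) (x n j) <= (C1 + u^-1) * (r n i + r n j).
    rewrite (le_trans (metric_triangle _ (g z) _))// (metric_sym (g z)).
    rewrite mulrDr lerD// ?(le_trans (ltW (QE _ _ _ Qz)))//.
      by rewrite ler_wpM2r// ?lerDl ltW.
    by rewrite (le_trans (ltW xz))// ler_wpM2r// ?lerDr ltW// (lt_le_trans ltr01).
  have [ji ij] : r n j <= C3 * r n i /\ r n i <= C3 * r n j.
    by rewrite -ler_pdivrMl ?(lt_le_trans ltr01).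
  have cj := gauge_neighbours gf A1 C31 D1 (rge0 n i) (rge0 n j)
    xij ji (ra n i) (ltW (ar n j)).
  (* The situation is symmetric in [i] and [j], so the same comparison with the roles exchanged
     gives the other inequality. *)
  rewrite metric_sym (addrC (r n i)) in xij.
  have ci := gauge_neighbours gf A1 C31 D1 (rge0 n j) (rge0 n i)
    xij ij (ra n j) (ltW (ar n i)).
  have c0 : 0 < c by rewrite (lt_le_trans ltr01).
  rewrite -/c in ci cj; clearbody c.
  by rewrite !mulrA !ler_pM2r ?invr_gt0// ci andbT ler_pdivrMl.
- rewrite (regular_setE S); apply/seteqP; split=> [_ [z Ez <-] n _|z Ez].
    have [[i j] /= Qx [Qz nQz]] := Ez n I.
    by exists (i, j); rewrite /= ?fK.
  exists (g z) => // n _; have [[i j] /= Qx [Qz nQz]] := Ez n I.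
  by exists (i, j) => //=; move: Qx; rewrite /= fK.
Qed.
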